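(* For a given $d$ and partitions $\Delta_1,\Delta_2\vdash d$, as operators on the functions of the time-variables $p=(p_1,p_2,\dots)$, the genus expanded cut-and-join operators satisfy $$W(\Delta_1,z)\,W(\Delta_2,z)=\sum_{\Delta_3\vdash d} z^{\,d-l(\Delta_1)-l(\Delta_2)+l(\Delta_3)}\,C_{\Delta_1\Delta_2}^{\Delta_3}\,W(\Delta_3,z),$$ where $$C_{\Delta_1\Delta_2}^{\Delta_3}=\frac{d!}{|C_{\Delta_3}|}\,\mu_0^{h,d}(\Delta_1,\Delta_2,\Delta_3)$$ are the structure constants of the central subalgebra $Z(\mathbb{C}[S_d])$ of the group algebra $\mathbb{C}[S_d]$.
   Context: The time-variables $p=(p_1,p_2,\dots)$ are indeterminates, and $z$ is a further parameter. For a partition $\Delta=(\delta_1,\dots,\delta_n)\vdash d$: $l(\Delta)=n$; $m_r(\Delta)=\#\{i:\delta_i=r\}$; $\Delta!=\prod_{r\ge1}m_r(\Delta)!$; $p_\Delta=p_{\delta_1}\cdots p_{\delta_n}$; $\frac{\partial}{\partial p_\Delta}=\frac{1}{\Delta!}\frac{\partial}{\partial p_{\delta_1}}\cdots\frac{\partial}{\partial p_{\delta_n}}$. $S_d$ is the symmetric group on $d$ letters; $C_\Delta\in Z(\mathbb{C}[S_d])$ is the central element corresponding to $\Delta$ (the sum of all permutations in $S_d$ of cycle type $\Delta$), and $|C_\Delta|$ is the number of such permutations. The structure constants are taken with respect to the elements $C_\Delta$, $\Delta\vdash d$. For $\lambda\vdash d$, $\dim\lambda$ and $\chi_\lambda(\Delta)$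 denote the dimension of the irreducible representation of $S_d$ indexed by $\lambda$ and its character value on permutations of cycle type $\Delta$, and $\phi_\lambda(\Delta)=\frac{1}{\dim\lambda}|C_\Delta|\chi_\lambda(\Delta)$. Generalized Hurwitz numbers: for $g\ge0$ and $\Delta_1,\dots,\Delta_k\vdash d$, $\mu_g^{h,d}(\Delta_1,\dots,\Delta_k)$ denotes the generalized Hurwitz number counting, up to equivalence, degree $d$ ramified coverings of a connected compact Riemann surface of genus $g$ by possibly disconnected compact Riemann surfaces of genus $h$, with ramification types $\Delta_1,\dots,\Delta_k$ over $k$ given points. It is given by $$\mu_g^{h,d}(\Delta_1,\dots,\Delta_k)=\sum_{\lambda\vdash d}\Big(\frac{\dim\lambda}{d!}\Big)^{2-2g}\phi_\lambda(\Delta_1)\cdots\phi_\lambda(\Delta_k),$$ where $h$ is determined by the Hurwitz formula $(2-2g)d-(2-2h)=\sum_{i=1}^k(d-l(\Delta_i))$. Genus expanded cut-and-join operator of $\Delta\vdash d$: $$W(\Delta,z)=\sum_{\Gamma,\Gamma'\vdash d}\frac{d!}{|C_{\Gamma'}|}\,z^{\,d+l(\Gamma')-l(\Delta)-l(\Gamma)}\,\mu_0^{h_+,d}(\Gamma',\Delta,\Gamma)\,p_\Gamma\frac{\partial}{\partial p_{\Gamma'}},$$ with $h_+$ determined by $2d-(2-2h_+)=(d-l(\Gamma'))+(d-l(\Delta))+(d-l(\Gamma))$.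
   Formalization: The operator identity is stated on polynomials in p of weighted degree at most d (deg p_i = i); on all functions it is false: for d=1, W=p_1 ∂/∂p_1 and structure constant 1, but WW p_1^2 = 4p_1^2 while W p_1^2 = 2p_1^2. *)

(* Defs.v *)
From HB Require Import structures.
From mathcomp Require Import all_boot all_order all_fingroup all_algebra.
From mathcomp Require Import all_solvable all_field all_character.
From mathcomp Require Import finmap monalg.

Set Implicit Arguments.
Unset Strict Implicit.
Unset Printing Implicit Defensive.

Import GRing.Theory.

Local Open Scope ring_scope.

Definition is_partition (d : nat) (s : seq nat) : bool :=
  [&& sorted geq s, 0%N \notin s & sumn s == d].

(* A partition of d has at most d parts, each at most d (see [partsP]); storing
   it as a bounded sequence over 'I_d.+1 makes [intpartn d] a finType. *)
Record intpartn (d : nat) : predArgType := IntPartn {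
  intpartn_val : d.-bseq 'I_d.+1;
  _ : is_partition d [seq nat_of_ord i | i <- intpartn_val]
}.

HB.instance Definition _ d := [isSub for @intpartn_val d].
HB.instance Definition _ d := [Finite of intpartn d by <:].

Definition parts d (D : intpartn d) : seq nat :=
  [seq nat_of_ord i | i <- intpartn_val D].

Lemma partsP d (s : seq nat) :
  reflect (exists D : intpartn d, parts D = s) (is_partition d s).
Proof.
apply: (iffP idP) => [s_d|[[t t_d] <-]]; last exact: t_d.
have [_ s_gt0 /eqP sum_s] := and3P s_d.
have size_s : (size s <= d)%N.
  rewrite -sum_s; elim: s s_gt0 {s_d sum_s} => //= x s IHs.
  rewrite inE negb_or eq_sym -lt0n => /andP[x_gt0 /IHs le_s].
  by rewrite -add1n leq_add.
have le_d x : x \in s -> (x <= d)%N.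
  rewrite -sum_s; elim: s {s_d s_gt0 sum_s size_s} => //= y s IHs.
  rewrite inE => /predU1P[->|/IHs le_x]; first exact: leq_addr.
  exact: leq_trans le_x (leq_addl _ _).
have vals : [seq nat_of_ord i | i <- [seq inord x : 'I_d.+1 | x <- s]] = s.
  by rewrite -map_comp map_id_in // => x /le_d x_d /=; rewrite inordK ?ltnS.
have sz : (size [seq inord x : 'I_d.+1 | x <- s] <= d)%N by rewrite size_map.
have isp : is_partition d [seq nat_of_ord i | i <- Bseq sz] by rewrite vals.
by exists (IntPartn isp).
Qed.

Section Partitions.
Variable d : nat.
Implicit Type D : intpartn d.

Definition plen D : nat := size (parts D).

Definition pfact D : nat := \prod_(1 <= r < d.+1) (count_mem r (parts D))`!.

Definition cycle_type (s : 'S_d) : seq nat :=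
  sort geq (map (fun A : {set 'I_d} => #|A|) (enum (porbits s))).

Definition cycle_class D : {set 'S_d} := [set s | cycle_type s == parts D].

(* C_D, in MathComp's model of the group algebra of S_d over the complex
   algebraic numbers (the enveloping algebra of the regular representation). *)
Definition class_elt D := gset_mx algC [set: 'S_d] (cycle_class D).

(* phi_lambda(D).  MathComp indexes the irreducible characters of S_d by
   [Iirr [set: 'S_d]]; the partition lambda serves only as a label of the
   representation, so lambda |- d is replaced by an index of this type. *)
Definition phi (lam : Iirr [set: 'S_d]) D : algC :=
  #|cycle_class D|%:R * 'chi_lam (repr (cycle_class D)) / 'chi_lam 1%g.

(* mu_g^{h,d}(D_1, ..., D_k).  The genus h is not an argument: it is determined
   by the other data and does not occur on the right-hand side. *)
Definition hurwitz (g : nat) (Ds : seq (intpartn d)) : algC :=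
  \sum_(lam : Iirr [set: 'S_d])
     ('chi_lam 1%g / d`!%:R) ^ (2%:Z - 2%:Z * g%:Z) *
     \prod_(D <- Ds) phi lam D.

Definition struct_const D1 D2 D3 : algC :=
  d`!%:R / #|cycle_class D3|%:R * hurwitz 0 [:: D1; D2; D3].

End Partitions.

Section CutAndJoin.
Variable K : fieldType.

(* Polynomials over K in p_1, p_2, ...; the variable of index i is p_{i+1}. *)
Definition timepoly := {malg K[{cmonom nat}]}.

Definition pvar (r : nat) : timepoly := << ucm r.-1 >>.

Definition dpvar (r : nat) (f : timepoly) : timepoly :=
  \sum_(m <- msupp f) << f@_m *+ m r.-1 *g divcm m (ucm r.-1) >>.

Definition weight (m : {cmonom nat}) : nat :=
  \sum_(i <- finsupp m) m i * i.+1.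

(* Compositions of degree d cut-and-join operators are only compared on f with
   [weight_le d f]: already for d = 1, where W((1), z) = p_1 d/dp_1, one has
   W W (p_1 ^ 2) = 4 p_1 ^ 2 whereas W (p_1 ^ 2) = 2 p_1 ^ 2. *)
Definition weight_le (d : nat) (f : timepoly) : Prop :=
  forall m, m \in msupp f -> (weight m <= d)%N.

Section Degree.
Variable d : nat.

Definition pmon (D : intpartn d) : timepoly := \prod_(r <- parts D) pvar r.

Definition dpmon (D : intpartn d) (f : timepoly) : timepoly :=
  (pfact D)%:R^-1 *: foldr dpvar f (parts D).

(* The coefficients of functions and the parameter z live in an arbitrary field
   K over algC (so z may be transcendental); the Hurwitz numbers live in algC
   and are transported to K along iota.  The exponent of z is an integer; it is
   negative only for terms whose Hurwitz number is 0. *)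
Definition cutjoin (iota : {rmorphism algC -> K}) (z : K) (D : intpartn d)
    (f : timepoly) : timepoly :=
  \sum_(G : intpartn d) \sum_(G' : intpartn d)
    (iota (d`!%:R / #|cycle_class G'|%:R) *
     z ^ (d%:Z + (plen G')%:Z - (plen D)%:Z - (plen G)%:Z) *
     iota (hurwitz 0 [:: G'; D; G])) *: (pmon G * dpmon G' f).

End Degree.
End CutAndJoin.

(* Main.v *)
(* On f of weight at most d, the operator d/dp_D extracts the coefficient of the
   monomial p_D, so W(D, z) acts as the matrix whose entry in row G and column
   G' is z^(d + l(G') - l(D) - l(G)) times the structure constant C_{D G}^{G'}.
   The powers of z multiply consistently, and the first identity reduces to the
   associativity of Z(C[S_d]); this is read off the central characters phi_lam,
   since the Frobenius formula expresses C_{D G}^{G'} through them.  When z = 0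
   the exponents must moreover be nonnegative on nonzero terms: this is the
   triangle inequality for the length d - #cycles on S_d. *)
Require Import Defs.
From mathcomp Require Import all_boot all_order all_fingroup all_algebra.
From mathcomp Require Import all_solvable all_field all_character.
From mathcomp Require Import finmap monalg zify ring.

Set Implicit Arguments.
Unset Strict Implicit.
Unset Printing Implicit Defensive.

Import GRing.Theory Num.Theory.

Local Open Scope ring_scope.

(** * Cycles of permutations *)

Section PermCycles.
Variable T : finType.
Implicit Types s t u : {perm T}.

Lemma leq_porbits_tperm_mul s x y :
  (#|porbits s| <= #|porbits (tperm x y * s)%g|.+1)%N.
Proof.
have := porbits_mul_tperm s x y; rewrite /=.
have [<-|ne_xy] := eqVneq x y; first by rewrite porbit_id /=; lia.
by case: (x \notin _) => /=; lia.
Qed.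

Lemma card_porbits_le s : (#|porbits s| <= #|T|)%N.
Proof. exact: leq_imset_card. Qed.

Lemma card_porbits1 : #|porbits (1%g : {perm T})| = #|T|.
Proof.
rewrite /porbits card_imset // => x y /eqP.
by rewrite eq_porbit_mem => /porbitP[i ->]; rewrite expg1n perm1.
Qed.

(** Induction on the number of letters minus the number of cycles: if [s] moves [x], then [x]
    becomes a fixed point of [tperm x y * s] with [y] the preimage of [x], which splits a cycle and
    so adds exactly one. *)
Lemma min_prod_tperm s :
  {ts : seq (T * T) | s = (\prod_(t <- ts) tperm t.1 t.2)%g
                    & (size ts + #|porbits s|)%N = #|T|}.
Proof.
have [n] := ubnP (#|T| - #|porbits s|); elim: n s => // n IHn s /ltnSE le_s_n.
have [x s_x | s_id] := pickP (fun x => s x != x); last first.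
  have ->: s = 1%g by apply/permP=> x; apply/eqP/idPn; rewrite perm1 s_id.
  by exists nil; rewrite ?big_nil // card_porbits1.
have s_y : s (s^-1 x)%g = x by rewrite permKV.
set y := (s^-1 x)%g in s_y.
have xy : x != y by apply: contraNneq s_x => {1}->; rewrite s_y.
have x_y : x \in porbit s y by rewrite -[in X in X \in _]s_y (mem_porbit s 1).
have := porbits_mul_tperm s x y; rewrite /= x_y xy /= addn0 addn1 => card_ts.
have := card_porbits_le (tperm x y * s)%g; rewrite card_ts => lt_s.
have [|ts def_s size_ts] := IHn (tperm x y * s)%g.
  by rewrite card_ts subnS prednK ?subn_gt0.
exists ((x, y) :: ts); last by rewrite /= -size_ts card_ts addnS.
by rewrite big_cons -def_s tpermKg.
Qed.

(** Triangle inequality for [#|T| - #|porbits s|]: [s] is a product of that many transpositions, and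
    each of them, multiplied onto [t], removes at most one cycle. *)
Lemma card_porbitsM s t :
  (#|porbits s| + #|porbits t| <= #|T| + #|porbits (s * t)%g|)%N.
Proof.
have [ts -> <-] := min_prod_tperm s; rewrite addnAC addnC leq_add2r.
elim: ts => [|[x y] ts IHts]; first by rewrite big_nil mul1g.
rewrite big_cons -mulgA /=; apply: (leq_trans IHts).
by rewrite addSnnS leq_add2l leq_porbits_tperm_mul.
Qed.

(** Each equality says that [m] and [n] agree modulo the common orbit size. Hence sending the [n]-th
    iterate of [x] under [s] to that of [y] under [t] is well defined. *)
Lemma eq_expg_porbit s t x y m n :
    #|porbit s x| = #|porbit t y| ->
  (s ^+ m)%g x = (s ^+ n)%g x -> (t ^+ m)%g y = (t ^+ n)%g y.
Proof.
move=> eq_st.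
have red u z k : (u ^+ k)%g z = (u ^+ (k %% #|porbit u z|))%g z.
  rewrite {1}(divn_eq k #|porbit u z|) addnC expgD permM.
  rewrite mulnC expgM; set w := (u ^+ (k %% _))%g z.
  have w_fix : (u ^+ #|porbit u z|)%g w = w.
    by rewrite -(porbit_perm u (k %% #|porbit u z|) z) permX iter_porbit.
  by elim: (k %/ _)%N => [|j IHj]; rewrite ?perm1 // expgS permM w_fix.
rewrite (red s x m) (red s x n) (red t y m) (red t y n) -eq_st => eq_mn.
have lt k : (k %% #|porbit s x| < #|porbit s x|)%N.
  by rewrite ltn_mod lt0n card_porbit_neq0.
congr ((t ^+ _)%g _); apply/eqP.
rewrite -(nth_uniq x _ _ (uniq_traject_porbit s x)) ?size_traject //.
by rewrite !nth_traject // -!permX; apply/eqP.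
Qed.

Lemma porbits_conjg s t :
  porbits (s ^ t)%g = [set t @: A | A : {set T} in porbits s].
Proof.
have orb x : porbit (s ^ t)%g (t x) = t @: porbit s x.
  apply/setP=> y; apply/porbitP/imsetP=> [[i ->]|[_ /porbitP[i ->] ->]].
    exists ((s ^+ i)%g x); first exact: mem_porbit.
    by rewrite -conjXg -permM -conjgC permM.
  by exists i; rewrite -conjXg -!permM -conjgC.
apply/setP=> B; apply/imsetP/imsetP=> [[y _ ->]|[_ /imsetP[x _ ->] ->]].
  exists (porbit s (t^-1 y)%g); first exact: imset_f.
  by rewrite -orb permKV.
by exists (t x); rewrite ?orb.
Qed.

Definition cycle_lengths s : seq nat := [seq #|A| | A : {set T} in porbits s].

Lemma cycle_lengthsJ s t : perm_eq (cycle_lengths (s ^ t)%g) (cycle_lengths s).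
Proof.
rewrite /cycle_lengths porbits_conjg; have injt := imset_inj (@perm_inj _ t).
have -> : [seq #|A| | A : {set T} in porbits s] =
          [seq #|A| | A : {set T} <- [seq t @: B | B : {set T} <- enum (porbits s)]].
  by rewrite -map_comp; apply: eq_map => A /=; rewrite card_imset //; apply: perm_inj.
apply/perm_map/uniq_perm; rewrite ?enum_uniq // ?map_inj_uniq ?enum_uniq //.
move=> B; rewrite mem_enum; apply/imsetP/mapP => -[A].
  by move=> sA ->; exists A; rewrite ?mem_enum.
by rewrite mem_enum => sA ->; exists A.
Qed.

(* Matched orbits A and B of equal size get base points a and b; the map
   [s ^+ i a |-> t ^+ i b] intertwines s and t. *)
Lemma conjg_cycle_lengths s t :
  perm_eq (cycle_lengths s) (cycle_lengths t) -> exists u, t = (s ^ u)%g.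
Proof.
move=> eq_st; have /(perm_iotaP 0%N)[Is permI def_s] := eq_st.
set Es := enum (porbits s); set Et := enum (porbits t).
have size_Et : size (cycle_lengths t) = size Et by rewrite size_map.
(* [Is] matches the positions in the two lists of cycle lengths; [g] sends an orbit of [s] to the
   orbit of [t] at the matched position, which has the same size. *)
pose g (A : {set T}) := nth set0 Et (nth 0%N Is (index A Es)).
(* The default [x0] is returned only for empty [A]; on orbits the base point is independent of
   it. *)
pose base (A : {set T}) x0 := odflt x0 [pick x in A].
have size_Is : size Is = size Es.
  by rewrite -(size_map (nth 0%N (cycle_lengths t))) -def_s size_map.
have Es_g A : A \in porbits s -> g A \in porbits t /\ #|g A| = #|A|.
  rewrite -mem_enum -/Es => sA.
  have ltA : (index A Es < size Es)%N by rewrite index_mem.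
  have ltI : (nth 0%N Is (index A Es) < size Et)%N.
    have: nth 0%N Is (index A Es) \in iota 0 (size Et).
      by rewrite -size_Et -(perm_mem permI) mem_nth // size_Is.
    by rewrite mem_iota.
  split; first by rewrite -mem_enum mem_nth.
  rewrite -[in RHS](nth_index set0 sA).
  rewrite -[RHS](nth_map _ 0%N (fun B : {set T} => #|B|)) //.
  rewrite [X in nth _ X _]def_s (nth_map 0%N) ?size_Is //.
  by rewrite (nth_map set0).
have g_onto B : B \in porbits t -> exists2 A, A \in porbits s & g A = B.
  rewrite -mem_enum -/Et => tB.
  have ltB : (index B Et < size Et)%N by rewrite index_mem.
  have: index B Et \in Is by rewrite (perm_mem permI) mem_iota size_Et.
  move/(nthP 0%N)=> [i lti def_i]; rewrite size_Is in lti.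
  exists (nth set0 Es i); first by rewrite -mem_enum mem_nth.
  by rewrite /g index_uniq ?enum_uniq // def_i nth_index.
have baseP A x0 : A != set0 -> base A x0 \in A.
  by case/set0Pn=> x Ax; rewrite /base; case: pickP => // /(_ x); rewrite Ax.
have porbits_n0 u A : A \in porbits u -> A != set0.
  by case/imsetP=> x _ ->; rewrite -card_gt0 lt0n card_porbit_neq0.
have porbits_base u A x : A \in porbits u -> x \in A -> A = porbit u x.
  by case/imsetP=> y _ ->; rewrite -eq_porbit_mem => /eqP.
have base_irr A x0 x1 : A != set0 -> base A x0 = base A x1.
  by case/set0Pn=> x Ax; rewrite /base; case: pickP => // /(_ x); rewrite Ax.
pose f x := let A := porbit s x in let a := base A x in
  (t ^+ index x (traject s a #|A|))%g (base (g A) x).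
have fE A x0 n : A \in porbits s ->
    f ((s ^+ n)%g (base A x0)) = (t ^+ n)%g (base (g A) x0).
  move=> sA; have An0 := porbits_n0 _ _ sA.
  have [tgA cardgA] := Es_g _ sA; have gAn0 := porbits_n0 _ _ tgA.
  have defA := porbits_base _ _ _ sA (baseP A x0 An0).
  have defgA := porbits_base _ _ _ tgA (baseP (g A) x0 gAn0).
  rewrite /f porbit_perm -defA; set x := (s ^+ n)%g _.
  rewrite (base_irr _ x x0 gAn0) (base_irr _ x x0 An0).
  (* The index found in the trajectory may differ from [n], but both exponents lead to the same
     point. *)
  apply: (@eq_expg_porbit s t (base A x0)); first by rewrite -defA -defgA.
  have sx : x \in traject s (base A x0) #|A|.
    by rewrite {2}defA -porbit_traject mem_porbit.
  rewrite -/x [LHS]permX -(@nth_traject _ s _ #|A|).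
    by rewrite nth_index.
  by move: sx; rewrite -index_mem size_traject.
have porbE x : exists n, x = (s ^+ n)%g (base (porbit s x) x).
  have: base (porbit s x) x \in porbit s x.
    by apply: baseP; rewrite -card_gt0 lt0n card_porbit_neq0.
  by rewrite porbit_sym => /porbitP[n def_x]; exists n.
have fs x : f (s x) = t (f x).
  have [n def_x] := porbE x; rewrite def_x -permM -expgSr !fE ?imset_f //.
  by rewrite expgSr permM.
have f_onto y : exists x, f x = y.
  have [A sA gA] : exists2 A, A \in porbits s & g A = porbit t y.
    by apply: g_onto; apply: imset_f.
  have ty : porbit t y != set0 by rewrite -card_gt0 lt0n card_porbit_neq0.
  have := baseP _ y ty; rewrite porbit_sym => /porbitP[n def_y].
  by exists ((s ^+ n)%g (base A y)); rewrite fE // gA.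
have injf : injective f.
  have codf : codom f =i T.
    by move=> y; rewrite inE; have [x <-] := f_onto y; apply: codom_f.
  have /image_injP inj : #|image f T| == #|T| by rewrite (eq_card codf).
  by move=> x y; apply: inj.
exists (perm injf); apply: (mulgI (perm injf)); rewrite -conjgC.
by apply/permP=> x; rewrite !permM !permE fs.
Qed.

End PermCycles.

(** * The class algebra of the symmetric group *)

Section CycleClasses.
Variable d : nat.
Implicit Types (s t : 'S_d) (D : intpartn d).

Lemma geq_total : total geq. Proof. by move=> m n; apply: leq_total. Qed.

Lemma geq_trans : transitive geq.
Proof. by move=> m n p /= mn /leq_trans; apply. Qed.

Lemma geq_anti : antisymmetric geq.
Proof. by move=> m n; rewrite /= andbC -eqn_leq => /eqP. Qed.

Lemma parts_inj : injective (@parts d).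
Proof. by move=> D1 D2 /inj_map eqD; apply/val_inj/val_inj/eqD/ord_inj. Qed.

Lemma parts_partition D : is_partition d (parts D).
Proof. by apply/partsP; exists D. Qed.

Lemma parts_perm_inj D1 D2 : perm_eq (parts D1) (parts D2) -> D1 = D2.
Proof.
have [/and3P[s1 _ _] /and3P[s2 _ _]] := (parts_partition D1, parts_partition D2).
by move=> eqD; apply/parts_inj/(sorted_eq geq_trans geq_anti s1 s2 eqD).
Qed.

Lemma cycle_type_partition s : is_partition d (cycle_type s).
Proof.
apply/and3P; split; first exact: (sort_sorted geq_total).
  rewrite mem_sort; apply/mapP=> -[A]; rewrite mem_enum => /imsetP[x _ ->].
  by move/eqP; rewrite eq_sym (negPf (card_porbit_neq0 s x)).
rewrite (perm_sumn (_ : perm_eq _ (cycle_lengths s))) ?perm_sort //.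
rewrite sumnE big_map big_enum /=.
have /card_partition <- : partition (porbits s) [set: 'I_d]; last first.
  by rewrite cardsT card_ord.
rewrite /porbits; apply/and3P; split.
- rewrite eqEsubset subsetT; apply/subsetP=> x _; apply/bigcupP.
  by exists (porbit s x); [apply: imset_f | apply: porbit_id].
- apply/trivIsetP=> _ _ /imsetP[x _ ->] /imsetP[y _ ->]; apply: contraR.
  case/pred0Pn=> z /andP[/= xz yz]; rewrite eq_porbit_mem.
  by move: xz yz; rewrite -!eq_porbit_mem => /eqP->.
- apply/imsetP=> -[x _ /esym/eqP].
  by rewrite -cards_eq0 (negPf (card_porbit_neq0 s x)).
Qed.

Lemma eq_cycle_type s t : (cycle_type s == cycle_type t) = (s \in t ^: [set: 'S_d])%g.
Proof.
apply/eqP/imsetP=> [|[u _ ->]].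
  move/(perm_sortP geq_total geq_trans geq_anti); rewrite perm_sym.
  case/conjg_cycle_lengths=> u ->.
  by exists u; rewrite ?inE.
by apply/(perm_sortP geq_total geq_trans geq_anti)/cycle_lengthsJ.
Qed.

Lemma cycle_classE D s :
  s \in cycle_class D -> cycle_class D = (s ^: [set: 'S_d])%g.
Proof.
by rewrite inE => /eqP sD; apply/setP=> t; rewrite inE -sD eq_cycle_type.
Qed.

Lemma cycle_class_exists s : {D | s \in cycle_class D}.
Proof.
apply: sigW; have /partsP[D sD] := cycle_type_partition s.
by exists D; rewrite inE sD.
Qed.

Lemma cycle_class_inj D1 D2 s :
  s \in cycle_class D1 -> s \in cycle_class D2 -> D1 = D2.
Proof. by rewrite !inE => /eqP-> /eqP/parts_inj. Qed.

Lemma cycle_classV D s : s \in cycle_class D -> (s^-1)%g \in cycle_class D.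
Proof. by rewrite !inE /cycle_type porbitsV. Qed.

Lemma plen_cycle_class D s : s \in cycle_class D -> plen D = #|porbits s|.
Proof. by rewrite inE /plen => /eqP <-; rewrite size_sort size_map -cardE. Qed.

(** A permutation has the same cycles as its inverse, hence is conjugate to it. This removes the
    complex conjugation from the Frobenius formula. *)
Lemma irr_S_real (lam : Iirr [set: 'S_d]) s : (('chi_lam s)^* = 'chi_lam s)%C.
Proof.
have [D sD] := cycle_class_exists s; rewrite -char_inv ?irr_char //.
have := cycle_classV sD; rewrite (cycle_classE sD) => /imsetP[u _ ->].
by rewrite cfunJ ?inE.
Qed.

Definition class_index D : 'I_#|classes [set: 'S_d]| :=
  enum_rank_in (classes1 [group of [set: 'S_d]]) (cycle_class D).

Lemma class_indexK D s :
  s \in cycle_class D -> enum_val (class_index D) = cycle_class D.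
Proof.
by move=> sD; rewrite enum_rankK_in // (cycle_classE sD) mem_classes ?inE.
Qed.

Lemma class_eltE D s : s \in cycle_class D ->
  class_elt D = gring_class_sum algC (class_index D).
Proof. by move=> sD; rewrite /gring_class_sum (class_indexK sD). Qed.

(** Empty classes are treated apart, here and below: [phi], [class_elt] and the structure constants
    vanish on them, whereas [class_index] is then only a default index. *)
Lemma phi0 (lam : Iirr [set: 'S_d]) D : cycle_class D = set0 -> phi lam D = 0.
Proof. by rewrite /phi => ->; rewrite cards0 !mul0r. Qed.

Lemma phiE (lam : Iirr [set: 'S_d]) D s : s \in cycle_class D ->
  phi lam D = #|cycle_class D|%:R * 'chi_lam s / 'chi_lam 1%g.
Proof.
move=> sD; rewrite /phi; have := mem_repr _ sD.
by rewrite {2}(cycle_classE sD) => /imsetP[u _ ->]; rewrite cfunJ ?inE.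
Qed.

Lemma class_elt_central D :
  (class_elt D \in 'Z(group_ring algC [set: 'S_d]))%MS.
Proof.
have [D0 | [s sD]] := set_0Vmem (cycle_class D).
  by rewrite /class_elt D0 /gset_mx big_set0 linear0 sub0mx.
by rewrite (class_eltE sD) gring_class_sum_central.
Qed.

(** The class sum is central, so it acts on the representation [lam] by a scalar, which is [phi].
    The multiplicativity of central characters thus applies to [phi]. *)
Lemma phi_omega (lam : Iirr [set: 'S_d]) D : phi lam D = 'omega_lam[class_elt D].
Proof.
have [D0 | [s sD]] := set_0Vmem (cycle_class D).
  by rewrite phi0 // /class_elt D0 /gset_mx big_set0 raddf0.
rewrite (class_eltE sD) (@gring_mode_class_sum_eq _ _ _ _ s) ?(class_indexK sD) //.
by rewrite (phiE _ sD) -(cycle_classE sD).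
Qed.

(** * Structure constants: Frobenius formula, associativity, vanishing *)

Lemma hurwitz0E (D1 D2 D3 : intpartn d) :
  hurwitz 0 [:: D1; D2; D3] =
  \sum_lam ('chi[[set: 'S_d]]_lam 1%g / d`!%:R) ^+ 2 *
     (phi lam D1 * phi lam D2 * phi lam D3).
Proof. by apply: eq_bigr => lam _; rewrite !big_cons big_nil mulr1 mulrA. Qed.

Lemma struct_constC D1 D2 D3 : struct_const D1 D2 D3 = struct_const D2 D1 D3.
Proof.
by rewrite /struct_const !hurwitz0E; under eq_bigr do rewrite [phi _ D1 * _]mulrC.
Qed.

Lemma struct_const0 D1 D2 D3 : cycle_class D1 = set0 -> struct_const D1 D2 D3 = 0.
Proof.
move=> D1_0; rewrite /struct_const hurwitz0E big1 ?mulr0 // => lam _.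
by rewrite phi0 // !mul0r mulr0.
Qed.

(** Frobenius formula for the number of factorizations of [s3] into a product of elements of the
    first two classes; the size of the third class cancels against the one in [phi lam D3]. *)
Lemma struct_const_coef D1 D2 D3 s1 s2 s3 :
    s1 \in cycle_class D1 -> s2 \in cycle_class D2 -> s3 \in cycle_class D3 ->
  struct_const D1 D2 D3 =
    (gring_classM_coef (class_index D1) (class_index D2) (class_index D3))%:R.
Proof.
move=> D1s D2s D3s.
have inK D s (sD : s \in cycle_class D) : s \in enum_val (class_index D).
  by rewrite (class_indexK sD).
rewrite (gring_classM_coef_sum_eq (inK _ _ D1s) (inK _ _ D2s) (inK _ _ D3s)).
rewrite (class_indexK D1s) (class_indexK D2s) cardsT card_Sn.
rewrite /struct_const hurwitz0E !mulr_sumr; apply: eq_bigr => lam _.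
rewrite (phiE _ D1s) (phiE _ D2s) (phiE _ D3s) irr_S_real natrM.
have c3 : #|cycle_class D3|%:R != 0 :> algC.
  by rewrite pnatr_eq0 -lt0n card_gt0; apply/set0Pn; exists s3.
have := irr1_neq0 lam; have : d`!%:R != 0 :> algC by rewrite pnatr_eq0 -lt0n fact_gt0.
by move=> fd chi1; field; rewrite fd chi1.
Qed.

Lemma class_eltM D1 D2 :
  class_elt D1 *m class_elt D2 = \sum_D3 struct_const D1 D2 D3 *: class_elt D3.
Proof.
have elt0 D : cycle_class D = set0 -> class_elt D = 0.
  by rewrite /class_elt /gset_mx => ->; rewrite big_set0.
have [D1_0 | [s1 D1s]] := set_0Vmem (cycle_class D1).
  rewrite elt0 // mul0mx big1 // => D3 _.
  by rewrite struct_const0 // scale0r.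
have [D2_0 | [s2 D2s]] := set_0Vmem (cycle_class D2).
  rewrite (elt0 D2) // mulmx0 big1 // => D3 _.
  by rewrite struct_constC struct_const0 // scale0r.
rewrite (bigID (fun D => cycle_class D != set0)) /= addrC big1 ?add0r; last first.
  by move=> D /negPn/eqP D0; rewrite elt0 ?scaler0.
rewrite (class_eltE D1s) (class_eltE D2s) gring_classM_expansion.
(* [h'] inverts [class_index]: it maps a conjugacy class to the cycle type of a representative. *)
pose h' (k : 'I_#|classes [set: 'S_d]|) :=
  sval (cycle_class_exists (repr (enum_val k))).
have h'P k : enum_val k = cycle_class (h' k).
  have [s _ def_k] := imsetP (enum_valP k).
  have := svalP (cycle_class_exists (repr (enum_val k))); rewrite -/(h' k).
  have : repr (enum_val k) \in enum_val k.
    by apply: (mem_repr s); rewrite def_k class_refl.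
  by rewrite {2}def_k => /class_eqP eq_k /cycle_classE ->; rewrite eq_k.
rewrite (reindex_onto class_index h') /=; last first.
  move=> k _; rewrite /class_index -h'P; apply: enum_valK_in.
(* The reindexing condition [h' (class_index D) == D] holds exactly when the class of [D] is
   nonempty. *)
apply: eq_big => [D|D /eqP hD].
  apply/eqP/set0Pn=> [hD|[s sD]].
    have [s _ def_k] := imsetP (enum_valP (class_index D)).
    by exists s; rewrite -[in cycle_class D]hD -h'P def_k class_refl.
  by apply: (@cycle_class_inj _ _ s) => //; rewrite -h'P (class_indexK sD).
have [s _ def_k] := imsetP (enum_valP (class_index D)).
have sD : s \in cycle_class D by rewrite -hD -h'P def_k class_refl.
by rewrite -(class_eltE sD) (struct_const_coef D1s D2s sD).
Qed.

Lemma phiM (lam : Iirr [set: 'S_d]) D1 D2 :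
  phi lam D1 * phi lam D2 = \sum_D3 struct_const D1 D2 D3 * phi lam D3.
Proof.
rewrite !phi_omega -gring_irr_modeM ?class_elt_central // class_eltM raddf_sum /=.
by apply: eq_bigr => D3 _; rewrite xcfunZr phi_omega.
Qed.

(** Both sides equal the genus 0 character sum with four entries [D1], [D2], [G], [G']: [phiM]
    merges [D1] with [G] on the left and [D1] with [D2] on the right. *)
Lemma struct_constA D1 D2 G G' :
  \sum_M struct_const D2 M G' * struct_const D1 G M =
  \sum_D3 struct_const D1 D2 D3 * struct_const D3 G G'.
Proof.
transitivity (d`!%:R / #|cycle_class G'|%:R *
   \sum_lam ('chi[[set: 'S_d]]_lam 1%g / d`!%:R) ^+ 2 *
     (phi lam D1 * phi lam D2 * phi lam G * phi lam G')).
  under eq_bigr do rewrite mulrC {2}/struct_const hurwitz0E mulrCA.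
  rewrite -mulr_sumr; congr (_ * _).
  under eq_bigr do rewrite mulr_sumr.
  rewrite exchange_big; apply: eq_bigr => lam _ /=.
  rewrite [phi _ D1 * _ * _]mulrAC phiM !mulr_suml mulr_sumr.
  by apply: eq_bigr => M _; ring.
under [RHS]eq_bigr do rewrite {2}/struct_const hurwitz0E mulrCA.
rewrite -mulr_sumr; congr (_ * _).
under [RHS]eq_bigr do rewrite mulr_sumr.
rewrite exchange_big; apply: eq_bigr => lam _ /=.
rewrite phiM !mulr_suml mulr_sumr.
by apply: eq_bigr => M _; ring.
Qed.

(** A nonzero constant yields a factorization of an element of the third class, to which
    [card_porbitsM] applies. This keeps the relevant exponents of [z] nonnegative. *)
Lemma struct_const_neq0 D1 D2 D3 :
  struct_const D1 D2 D3 != 0 -> (plen D1 + plen D2 <= d + plen D3)%N.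
Proof.
have [D1_0|[s1 D1s]] := set_0Vmem (cycle_class D1).
  by rewrite struct_const0 ?eqxx.
have [D2_0|[s2 D2s]] := set_0Vmem (cycle_class D2).
  by rewrite struct_constC struct_const0 ?eqxx.
have [D3_0|[s3 D3s]] := set_0Vmem (cycle_class D3).
  by rewrite /struct_const D3_0 cards0 invr0 mulr0 mul0r eqxx.
rewrite (struct_const_coef D1s D2s D3s) pnatr_eq0 -lt0n.
rewrite (@set_gring_classM_coef _ _ _ _ _ s3) ?(class_indexK D3s) //.
rewrite (class_indexK D1s) (class_indexK D2s) card_gt0 => /set0Pn[[t1 t2]].
case/setIdP=> /andP[/plen_cycle_class -> /plen_cycle_class ->] /eqP def_s3.
rewrite (plen_cycle_class D3s) -def_s3 -[X in (_ <= X + _)%N]card_ord.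
exact: card_porbitsM.
Qed.

End CycleClasses.

(** * The matrix of a cut-and-join operator *)

Section Monomials.

Lemma weightE (A : {fset nat}) (m : {cmonom nat}) :
  (finsupp m `<=` A)%fset -> weight m = (\sum_(i <- A) m i * i.+1)%N.
Proof.
move=> mA; apply: big_fset_incl mA _ => i _; rewrite -cmE_eq0.
by move/eqP=> ->; rewrite mul0n.
Qed.

Lemma weightM (m1 m2 : {cmonom nat}) :
  weight (mmul m1 m2) = (weight m1 + weight m2)%N.
Proof.
pose A := (finsupp m1 `|` finsupp m2)%fset.
rewrite (@weightE A m1) ?fsubsetUl // (@weightE A m2) ?fsubsetUr //.
rewrite (@weightE A) ?mdomD // -big_split /=.
by apply: eq_bigr => i _; rewrite cmM mulnDl.
Qed.

Lemma weight1 : weight mone = 0%N.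
Proof. by rewrite /weight mdom1 big_nil. Qed.

Lemma weightU i : weight (ucm i) = i.+1.
Proof. by rewrite /weight mdomU big_seq_fset1 cmUU mul1n. Qed.

Lemma weight_eq0 m : weight m = 0%N -> m = mone.
Proof.
move=> wm; apply/eqP/cmP=> i; rewrite cm1.
apply/eqP; rewrite cmE_eq0; apply/negP=> mi; move: wm.
rewrite /weight (big_rem i) //= => /eqP; rewrite addn_eq0 muln_eq0 orbF.
by rewrite cmE_eq0 mi.
Qed.

(** Exponent vector of the product of the variables indexed by [s]. A part 0 would be confused with
    a part 1 by the shift [r.-1], whence the condition [0%N \notin s] below. *)
Definition monom_of (s : seq nat) : {cmonom nat} :=
  foldr (fun r m => mmul (ucm r.-1) m) mone s.

Lemma monom_ofE s i : 0%N \notin s -> monom_of s i = count_mem i.+1 s.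
Proof.
elim: s => [|r s IHs]; first by rewrite /= cm1.
rewrite inE negb_or => /andP[r_gt0 /IHs IH]; rewrite /= cmM cmU IH.
by case: r r_gt0 => // r _; rewrite eqSS.
Qed.

Lemma weight_monom_of s : 0%N \notin s -> weight (monom_of s) = sumn s.
Proof.
elim: s => [|r s IHs]; first by rewrite /= weight1.
rewrite inE negb_or => /andP[r_gt0 /IHs IH]; rewrite /= weightM weightU IH.
by case: r r_gt0.
Qed.

End Monomials.

(** * Coefficients of derivatives and of cut-and-join operators *)

Section TimePoly.
Variable K : fieldType.
Implicit Types (f : timepoly K) (k m : {cmonom nat}).

(** Only the monomial [k] times the variable of [r] contributes to the coefficient at [k]. *)
Lemma mcoeff_dpvar r f k :
  (dpvar r f)@_k = f@_(mmul k (ucm r.-1)) *+ (k r.-1).+1.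
Proof.
have kuE : mmul k (ucm r.-1) r.-1 = (k r.-1).+1 by rewrite cmM cmUU addn1.
pose F m := (<< f@_m *+ m r.-1 *g divcm m (ucm r.-1) >> : timepoly K)@_k.
transitivity (\sum_(m <- msupp f) F m); first by rewrite /dpvar raddf_sum.
move defku: (mmul k (ucm r.-1)) kuE => ku kuE.
have F_ne m : m != ku -> F m = 0.
  move=> ne_m; rewrite /F mcoeffU; case: eqP => [def_k|]; last by rewrite mulr0n.
  (* Division of monomials truncates, so [m] free of the variable may also have quotient [k]; its
     coefficient is then multiplied by 0. *)
  case: (posnP (m r.-1)) => [->|m_gt0]; first by rewrite !mulr0n ?mul0rn.
  case/eqP: ne_m; rewrite -defku; apply/eqP/cmP=> i; rewrite cmM -def_k divcmE cmU.
  by case: eqP => [<-|_]; rewrite ?subn0 ?addn0 // subnK.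
have F_ku : F ku = f@_ku *+ (k r.-1).+1.
  rewrite /F mcoeffU kuE (_ : divcm _ _ = k) ?eqxx //.
  by apply/eqP/cmP=> i; rewrite divcmE -defku cmM addnK.
rewrite -F_ku; move: F F_ne F_ku => F F_ne F_ku.
have [fku | fku] := boolP (ku \in msupp f).
  rewrite (big_fsetD1 ku fku) big1_fset; first exact: addr0.
  by move=> m; rewrite !inE => /andP[/F_ne].
rewrite F_ku (mcoeff_outdom fku) mul0rn big1_fset // => m fm _.
by apply: F_ne; apply: contraNneq fku => <-.
Qed.

Lemma mcoeff_foldr_dpvar d s f k :
    0%N \notin s -> all (leq^~ d) s ->
  (foldr (@dpvar K) f s)@_k = f@_(mmul k (monom_of s)) *+
    \prod_(1 <= r < d.+1) ((k r.-1 + count_mem r s) ^_ (count_mem r s)).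
Proof.
elim: s k => [|r s IHs] k; first by rewrite /= mulm1 big1 // => r _; rewrite ffactn0.
rewrite inE negb_or => /andP[r_gt0 s_gt0] /= /andP[le_r le_s].
rewrite mcoeff_dpvar IHs // -mulmA -mulrnA; congr (_ *+ _).
have r_in : r \in index_iota 1 d.+1 by rewrite mem_index_iota lt0n eq_sym r_gt0.
(* With [a] the exponent in [k] and [c] the multiplicity of [r] in [s], the new factor [a + 1] turns
   [(a + c + 1) ^_ c] into [(a + c + 1) ^_ (c + 1)]. *)
rewrite !(bigD1_seq r) ?iota_uniq //= cmM cmUU eqxx mulnAC; congr (_ * _)%N.
  by rewrite add1n ffactnSr -addnA add1n addnS -addSn addnK.
rewrite big_seq_cond [RHS]big_seq_cond; apply: eq_bigr => q.
rewrite mem_index_iota => /andP[/andP[q_gt0 _] ne_qr].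
rewrite cmM cmU [r == q]eq_sym (negPf ne_qr).
have -> : (r.-1 == q.-1) = false; last by rewrite addn0.
apply: contraNF ne_qr; rewrite eq_sym.
by case: q r q_gt0 r_gt0 {s_gt0 le_r r_in} => [|q] [|r].
Qed.

Lemma prod_pvar (s : seq nat) : \prod_(r <- s) pvar K r = << monom_of s >>.
Proof.
elim: s => [|r s IHs]; first by rewrite big_nil.
rewrite big_cons IHs.
have -> : (pvar K r * << monom_of s >> : timepoly K) =
    << 1 * 1 *g mmul (ucm r.-1) (monom_of s) >>.
  exact: fgmulUU.
congr (mkmalgU _ _). exact: mulr1.
Qed.

Lemma weight_leE d f : weight_le d f <-> (forall m, f@_m != 0 -> (weight m <= d)%N).
Proof. by split=> wf m fm; apply: wf; rewrite mcoeff_neq0 in fm *. Qed.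

Section Degree.
Variable d : nat.
Implicit Types D G : intpartn d.

Definition monom D := monom_of (parts D).

Lemma parts_gt0 D : 0%N \notin parts D.
Proof. by have /and3P[] := parts_partition D. Qed.

Lemma sumn_parts D : sumn (parts D) = d.
Proof. by have /and3P[_ _ /eqP] := parts_partition D. Qed.

Lemma weight_monom D : weight (monom D) = d.
Proof. by rewrite weight_monom_of ?parts_gt0 // sumn_parts. Qed.

Lemma monom_inj : injective monom.
Proof.
move=> D1 D2 eqD; apply: parts_perm_inj; apply/allP=> r _ /=; apply/eqP.
case: r => [|r]; first by rewrite !(count_memPn _) ?parts_gt0.
by rewrite -!monom_ofE ?parts_gt0 // -!/(monom _) eqD.
Qed.

Lemma pmonE D : pmon K D = << monom D >>.
Proof. exact: prod_pvar. Qed.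

(** A monomial [k] in the derivative comes from [k] times [monom D], of weight [weight k + d]; the
    bound on [f] forces [k] to be 1. There the falling factorials are factorials, cancelled by
    [pfact D]. *)
Lemma dpmonE (iota : {rmorphism algC -> K}) D f : weight_le d f ->
  dpmon D f = f@_(monom D) *: 1.
Proof.
move=> /weight_leE wf; apply/malgP=> k; rewrite [LHS]mcoeffZ [RHS]mcoeffZ.
have le_d : all (leq^~ d) (parts D).
  by apply/allP=> r /mapP[i _ ->]; rewrite -ltnS ltn_ord.
rewrite (mcoeff_foldr_dpvar _ _ (parts_gt0 D) le_d) -/(monom D) mcoeff1.
case: (eqVneq k mone) => [->|k_neq1].
  rewrite mul1m mulr1 -[f@_ _ *+ _]mulr_natl mulrA.
  have -> : (\prod_(1 <= r < d.+1)
      (((mone : {cmonom nat}) r.-1 + count_mem r (parts D))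
         ^_ (count_mem r (parts D))))%N = pfact D.
    by apply: eq_bigr => r _; rewrite cm1 add0n ffactnn.
  (* [K] has characteristic 0 because it receives [algC], so [pfact D] is invertible. *)
  rewrite mulVf ?mul1r // -(rmorph_nat iota) fmorph_eq0 pnatr_eq0 -lt0n.
  by apply: prodn_gt0 => r; apply: fact_gt0.
rewrite mulr0; have [->|/wf] := eqVneq (f@_(mmul k (monom D))) 0.
  by rewrite mul0rn mulr0.
rewrite weightM weight_monom -[X in (_ <= X)%N]add0n leq_add2r leqn0.
by move/eqP/weight_eq0/eqP; rewrite (negPf k_neq1).
Qed.

(** Matrix entry in column [G'] and row [G]. By symmetry of the Hurwitz number, its factor
    [d! / |C_G'|] makes it the structure constant with upper index [G']. *)
Definition cutjoin_coef (iota : {rmorphism algC -> K}) (z : K) D G' G : K :=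
  z ^ (d%:Z + (plen G')%:Z - (plen D)%:Z - (plen G)%:Z) * iota (struct_const D G G').

Lemma cutjoinE (iota : {rmorphism algC -> K}) (z : K) D f :
    weight_le d f ->
  cutjoin iota z D f =
  \sum_G (\sum_G' cutjoin_coef iota z D G' G * f@_(monom G')) *: << monom G >>.
Proof.
move=> wf; apply: eq_bigr => G _; rewrite scaler_suml; apply: eq_bigr => G' _.
have -> : pmon K G * dpmon G' f = f@_(monom G') *: << monom G >>.
  rewrite (dpmonE iota _ wf) pmonE; set x : timepoly K := << _ >>.
  by rewrite -(scalerAr _ x 1) (mulr1 x).
apply: (etrans (scalerA _ _ _)); apply: (congr1 (GRing.scale^~ _)).
congr (_ * _).
rewrite /cutjoin_coef /struct_const mulrAC -rmorphM mulrC; congr (_ * iota (_ * _)).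
by rewrite !hurwitz0E; apply: eq_bigr => lam _; ring.
Qed.

Lemma mcoeff_cutjoin (iota : {rmorphism algC -> K}) (z : K) D f k :
    weight_le d f ->
  (cutjoin iota z D f)@_k =
  \sum_G (\sum_G' cutjoin_coef iota z D G' G * f@_(monom G')) *+ (monom G == k).
Proof.
move=> wf; rewrite cutjoinE // raddf_sum; apply: eq_bigr => G _ /=.
by rewrite mcoeffZ mcoeffU mulrnAr mulr1.
Qed.

(** The image is spanned by monomials of weight exactly [d], so a second operator can be applied
    through its matrix. *)
Lemma weight_le_cutjoin (iota : {rmorphism algC -> K}) (z : K) D f :
  weight_le d f -> weight_le d (cutjoin iota z D f).
Proof.
move=> wf; apply/weight_leE=> m; rewrite mcoeff_cutjoin //.
case: (pickP (fun G => monom G == m)) => [G /eqP <- _|no_G].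
  by rewrite weight_monom.
by rewrite big1 ?eqxx // => G _; rewrite no_G mulr0n.
Qed.

Lemma mcoeff_cutjoin_monom (iota : {rmorphism algC -> K}) (z : K) D f G :
    weight_le d f ->
  (cutjoin iota z D f)@_(monom G) =
  \sum_G' cutjoin_coef iota z D G' G * f@_(monom G').
Proof.
move=> wf; rewrite mcoeff_cutjoin // (bigD1 G) //= eqxx mulr1n.
rewrite [X in _ + X]big1 ?addr0 // => G1.
by rewrite -(inj_eq monom_inj) => /negPf ->.
Qed.

End Degree.
End TimePoly.

(** * Product of the matrices and composition of the operators *)

Lemma cutjoin_coefM (K : fieldType) (iota : {rmorphism algC -> K}) (z : K) d
    (D1 D2 G G' : intpartn d) :
  \sum_M cutjoin_coef iota z D1 M G * cutjoin_coef iota z D2 G' M =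
  \sum_D3 z ^ (d%:Z - (plen D1)%:Z - (plen D2)%:Z + (plen D3)%:Z) *
     iota (struct_const D1 D2 D3) * cutjoin_coef iota z D3 G' G.
Proof.
(* z may be 0, and z ^ (e1 + e2) = z ^ e1 * z ^ e2 then fails for e1 = - e2 != 0. *)
have zM (e1 e2 : int) (x1 x2 : algC) :
    (x1 != 0 -> 0 <= e1) -> (x2 != 0 -> 0 <= e2) ->
  z ^ e1 * iota x1 * (z ^ e2 * iota x2) = z ^ (e1 + e2) * iota (x2 * x1).
  have [->|_ /(_ isT) e1_ge0] := eqVneq x1 0.
    by rewrite !(mulr0, rmorph0, mul0r).
  have [->|_ /(_ isT) e2_ge0] := eqVneq x2 0.
    by rewrite !(mulr0, mul0r, rmorph0).
  by rewrite exprzD_ss ?e1_ge0 ?e2_ge0 // (rmorphM iota); ring.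
(* [e] is the total exponent on both sides: [plen M] cancels on the left and [plen D3] on the right,
   so a common power of [z] factors out and [struct_constA] remains. *)
pose e := (2%:Z * d%:Z + (plen G')%:Z - (plen D1)%:Z - (plen D2)%:Z - (plen G)%:Z).
transitivity (z ^ e * iota (\sum_M struct_const D2 M G' * struct_const D1 G M)).
  rewrite raddf_sum mulr_sumr; apply: eq_bigr => M _ /=; rewrite zM.
  - by congr (z ^ _ * _); rewrite /e; lia.
  - by move/struct_const_neq0; lia.
  - by move/struct_const_neq0; lia.
rewrite struct_constA raddf_sum mulr_sumr; apply: eq_bigr => D3 _ /=; rewrite zM.
- by rewrite [X in iota X]mulrC; congr (z ^ _ * _); rewrite /e; lia.
- by move/struct_const_neq0; lia.
- by move/struct_const_neq0; lia.
Qed.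

Theorem theoremA (K : fieldType) (iota : {rmorphism algC -> K}) (z : K)
    (d : nat) (D1 D2 : intpartn d) :
  (forall f : timepoly K, weight_le d f ->
     cutjoin iota z D1 (cutjoin iota z D2 f) =
     \sum_(D3 : intpartn d)
       (z ^ (d%:Z - (plen D1)%:Z - (plen D2)%:Z + (plen D3)%:Z) *
        iota (struct_const D1 D2 D3)) *: cutjoin iota z D3 f)
  /\ class_elt D1 *m class_elt D2 =
     \sum_(D3 : intpartn d) struct_const D1 D2 D3 *: class_elt D3.
Proof.
split; last exact: class_eltM.
move=> f wf; rewrite (cutjoinE _ _ _ (weight_le_cutjoin wf)).
under [RHS]eq_bigr do rewrite cutjoinE // scaler_sumr.
(* Compare the coefficients of [monom G], then the contributions of each [f@_(monom G')]; this
   leaves the matrix identity [cutjoin_coefM]. *)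
rewrite exchange_big; apply: eq_bigr => G _ /=.
under [RHS]eq_bigr do rewrite scalerA.
rewrite -scaler_suml; apply: (congr1 (GRing.scale^~ _)).
under eq_bigr do rewrite mcoeff_cutjoin_monom // mulr_sumr.
under [RHS]eq_bigr do rewrite mulr_sumr.
rewrite exchange_big [RHS]exchange_big; apply: eq_bigr => G' _ /=.
under eq_bigr do rewrite mulrA.
under [RHS]eq_bigr do rewrite mulrA.
by rewrite -!mulr_suml cutjoin_coefM.
Qed.
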